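(* Let $\ell\ge 1$ be an integer. The map $\rho$ (defined in the context) is a bijection from the set of pairs $(c,p)$ such that car $c$ is in the right lane of the arrival sequence of length $\ell$ whose unique zero is in position $p$ (i.e. the set of all cars in the right lanes of all arrival sequences in $B_{\ell,1}$) onto the set of edges of a longest trail in $K_\ell^\circ$. Moreover, $R_{\ell,1}=T_\ell$.
   Context: An arrival sequence of length $\ell$ is a binary string $\mathbf{b}=b_1b_2\cdots b_\ell\in\{0,1\}^\ell$; $B_{\ell,1}$ is the set of those with exactly one zero. Cars $1,2,\dots,\ell$ arrive in order and choose between two initially empty lanes (left and right): if $b_i=0$, car $i$ enters the right lane; if $b_i=1$, car $i$ enters the currently shorter lane, and enters the right lane if both lanes have the same length. $r(\mathbf{b})$ denotes the final number of cars in the right lane, and $R_{\ell,1}=\sum_{\mathbf{b}\in B_{\ell,1}} r(\mathbf{b})$. $K_\ell^\circ$ is the complete graph on vertices $\{1,\dots,\ell\}$ with one loop added at every vertex; $(i,j)$ denotes the (undirected) edge joining $i$ and $j$, and $(i,i)$ the loop at $i$. A trail is a walk with no repeated edges (loops count as edges); $T_\ell$ is the maximum number of edges of a trail in $K_\ell^\circ$, and a longest trail is one with $T_\ell$ edges. For $p\in\{1,\dots,\ell\}$ and a car $c$ in the right lane of the arrival sequence of length $\ell$ with its unique zero in position $p$, the edge $\rho(c,p)$ of $K_\ell^\circ$ is defined as follows. If $\ell$ is even: $$\rho(c,p)=\begin{cases}(c+1,p) & c<p,\ p \text{ odd},\\ (p,c) & c\ge p,\ p\text{ odd},\\ (p,\ell)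 & c=p-1,\ p \text{ even},\ p<\ell,\\ (c,p) & c\le p,\ p\text{ even, and not both } c=p-1 \text{ and } p<\ell,\\ (p,c-1) & c>p,\ p \text{ even}.\end{cases}$$ If $\ell$ is odd: $$\rho(c,p)=\begin{cases}(c+1,p) & c<p,\ p\text{ odd},\\ (p,p) & c=p,\\ (p,c) & c>p,\ p\text{ odd},\\ (c,p) & c<p,\ p \text{ even},\\ (p,c-1) & c>p,\ p\text{ even}.\end{cases}$$ *)

(* Defs.v *)
From mathcomp Require Import all_boot.

Set Implicit Arguments.
Unset Strict Implicit.
Unset Printing Implicit Defensive.

(** Parking in two lanes *)

(* A state is the pair (left lane, right lane) of the lists of the numbers of
   the cars already parked; [bc] is a car together with its arrival bit, where
   [false] stands for 0 and [true] for 1. *)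
Definition park (st : seq nat * seq nat) (bc : nat * bool) :
    seq nat * seq nat :=
  if ~~ bc.2 || (size st.2 <= size st.1)
  then (st.1, rcons st.2 bc.1) else (rcons st.1 bc.1, st.2).

(* Cars are numbered from 1. *)
Definition lanes (b : seq bool) : seq nat * seq nat :=
  foldl park ([::], [::]) (zip (iota 1 (size b)) b).

Definition right_lane (b : seq bool) : seq nat := (lanes b).2.

Definition final_right (b : seq bool) : nat := size (right_lane b).

Definition arrivals (l k : nat) : {set l.-tuple bool} :=
  [set b : l.-tuple bool | count_mem false b == k].

Definition total_right (l k : nat) : nat :=
  \sum_(b in arrivals l k) final_right b.

(* For a sequence with exactly one zero, its 1-based position. *)
Definition zero_pos (b : seq bool) : nat := (index false b).+1.

(** Trails in finite graphs with loops *)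

(* A graph on a vertex set [V] is given by its set [E] of edges; the undirected
   edge joining x and y is [set x; y], so that the loop at x is [set x].
   A walk is a starting vertex [x] followed by the list [s] of the next
   vertices; it has [size s] edges. *)
Section Trails.

Variable T : finType.
Implicit Types (V : {set T}) (E : {set {set T}}) (x : T) (s : seq T).

Definition walk V E x s : bool :=
  (x \in V) && path (fun y z => [set y; z] \in E) x s.

Definition walk_edges x s : seq {set T} :=
  pairmap (fun y z => [set y; z]) x s.

Definition trail V E x s : bool := walk V E x s && uniq (walk_edges x s).

(* A trail has at most #|E| edges, so bounding the range of m loses nothing:
   see [leq_max_trail] and [max_trail_attained]. *)
Definition max_trail V E : nat :=
  \max_(m < #|E|.+1 | [exists x : T, exists s : m.-tuple T, trail V E x s]) m.

Definition longest_trail V E x s : bool :=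
  trail V E x s && (size s == max_trail V E).

Lemma size_trail V E x s : trail V E x s -> size s <= #|E|.
Proof.
case/andP=> /andP[_ ps] us.
have <- : size (walk_edges x s) = size s by rewrite size_pairmap.
have sE : {subset walk_edges x s <= enum E}.
  elim: s x ps {us} => [//|y s IHs] x /= /andP[xy /IHs ys] e.
  by rewrite inE => /predU1P[->|/ys //]; rewrite mem_enum.
by rewrite cardE; apply: uniq_leq_size.
Qed.

Lemma leq_max_trail V E x s : trail V E x s -> size s <= max_trail V E.
Proof.
move=> tr; have lt_s : size s < #|E|.+1 by rewrite ltnS (size_trail tr).
apply: (@leq_bigmax_cond _ _ (fun m : 'I_#|E|.+1 => m : nat) (Ordinal lt_s)).
by apply/existsP; exists x; apply/existsP; exists (in_tuple s).
Qed.

Lemma max_trail_attained V E :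
  V != set0 -> exists x s, longest_trail V E x s.
Proof.
case/set0Pn=> x0 Vx0.
pose P (m : 'I_#|E|.+1) :=
  [exists x : T, exists s : m.-tuple T, trail V E x s].
have P0 : P ord0.
  apply/existsP; exists x0; apply/existsP; exists [tuple].
  by rewrite /trail /walk Vx0.
have cP : 0 < #|P| by apply/card_gt0P; exists ord0.
have [m Pm eqm] := eq_bigmax_cond (fun m : 'I_#|E|.+1 => m : nat) cP.
have /existsP[x /existsP[s tr]] := Pm; exists x, s.
by rewrite /longest_trail tr size_tuple /max_trail eqm eqxx.
Qed.

End Trails.

(** The complete graph with loops *)

(* The vertices 1, ..., l are the nonzero elements of 'I_l.+1. *)
Definition vertices (l : nat) : {set 'I_l.+1} := [set v : 'I_l.+1 | 0 < v].

Definition looped_complete (l : nat) : {set {set 'I_l.+1}} :=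
  [set [set i; j] | i in vertices l, j in vertices l].

(* [inord k] has value k if k <= l and is 0, which is not a vertex, otherwise;
   so out-of-range endpoints never give an edge of the graph. *)
Definition edge (l i j : nat) : {set 'I_l.+1} := [set inord i; inord j].

Definition longest_trail_length (l : nat) : nat :=
  max_trail (vertices l) (looped_complete l).

(** The map from cars to edges *)

Definition rho (l c p : nat) : {set 'I_l.+1} :=
  if ~~ odd l then
    if odd p then
      if c < p then edge l c.+1 p else edge l p c
    else
      if (c == p.-1) && (p < l) then edge l p l
      else if c <= p then edge l c p
      else edge l p c.-1
  else
    if c == p then edge l p p
    else if odd p then
      if c < p then edge l c.+1 p else edge l p c
    else
      if c < p then edge l c p else edge l p c.-1.

(* The pairs (c, p) such that car c is in the right lane of the arrival sequence
   of length l whose unique zero is in position p. *)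
Definition right_cars (l : nat) : {set 'I_l.+1 * 'I_l.+1} :=
  [set cp : 'I_l.+1 * 'I_l.+1 | [exists b in arrivals l 1,
    (zero_pos b == cp.2) && ((cp.1 : nat) \in right_lane b)]].

(* Main.v *)
Require Import Defs.
From mathcomp Require Import all_boot.
From mathcomp Require Import zify.

Set Implicit Arguments.
Unset Strict Implicit.
Unset Printing Implicit Defensive.

(* Let E' be the set of all edges if l is odd, and of all edges but {1,2},
   {3,4}, ..., {l-3,l-2} if l is even, and let M = #|E'|. Three inequalities
   settle everything by cardinality: there are at most M right cars and rho maps
   them onto E', so rho is injective with image E'; some walk with at most M
   edges covers E', so it is a trail with edge set E'; and no trail has more
   than M edges, because for even l every vertex other than the two endpoints
   has odd degree and hence misses an edge. *)

(** * Cars in the right lane *)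

Definition single_zero (l p : nat) : l.-tuple bool :=
  [tuple of mkseq (fun i => i.+1 != p) l].

(** Without the zero, exactly the odd cars go right. A zero at odd [p] changes nothing; at even [p]
    it sends car p right and hence car p+1 left, after which car p+2 restores the balance. *)
Definition in_right (p c : nat) : bool := odd c && (c != p.+1) || (c == p).

Lemma iota1S n : iota 1 n.+1 = rcons (iota 1 n) n.+1.
Proof. by rewrite -cats1 -[RHS](iotaD 1 n 1) addn1. Qed.

Lemma lanes_rcons b x : lanes (rcons b x) = park (lanes b) ((size b).+1, x).
Proof.
by rewrite /lanes size_rcons iota1S zip_rcons ?size_iota // foldl_rcons.
Qed.

Lemma size_lanes b : size (lanes b).1 + size (lanes b).2 = size b.
Proof.
elim/last_ind: b => [//|b x IHb]; rewrite lanes_rcons /park size_rcons -IHb.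
by case: ifP => _ /=; rewrite size_rcons ?addnS.
Qed.

(** For even [p] the gain of car p is undone by the loss of car p+1, so it survives only when p is
    the last car. *)
Lemma count_in_right p l : 0 < p ->
  count (in_right p) (iota 1 l) = uphalf l + (~~ odd l && (l == p)).
Proof.
move=> p_gt0; elim: l => [|l IHl]; first by case: p p_gt0.
by rewrite iota1S -cats1 count_cat IHl /= /in_right; lia.
Qed.

Lemma right_lane_single_zero l p : 0 < p ->
  right_lane (single_zero l p) = [seq c <- iota 1 l | in_right p c].
Proof.
move=> p_gt0; elim: l => [//|l IHl].
pose st := lanes (single_zero l p).
have st2 : st.2 = [seq c <- iota 1 l | in_right p c] := IHl.
have stS : lanes (single_zero l.+1 p) = park st (l.+1, l.+1 != p).
  by rewrite [tval _]mkseqS lanes_rcons size_mkseq.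
(* The lane sizes add up to [l] and the right one is known by counting, so the comparison made by
   [park] becomes arithmetic. *)
have right_next :
    ~~ (l.+1 != p) || (size st.2 <= size st.1) = in_right p l.+1.
  have := size_lanes (single_zero l p); rewrite -/st size_tuple.
  by rewrite st2 size_filter count_in_right // /in_right; lia.
rewrite iota1S filter_rcons -st2 /right_lane stS /park /= right_next.
by case: ifP.
Qed.

(** The default [true] extends the equation to positions past the end. *)
Lemma nth_one_zero (b : seq bool) i : count_mem false b = 1 ->
  nth true b i = (i.+1 != zero_pos b).
Proof.
rewrite /zero_pos; elim: b i => [//|[] b IHb] [|i] //=; first exact: IHb.
move=> [] /count_memPn b0.
have [ltib|] := ltnP i (size b); last by move=> /(nth_default true) ->.
by have := mem_nth true ltib; case: nth => // /(negP b0).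
Qed.

Lemma arrivals1E l (b : l.-tuple bool) :
  b \in arrivals l 1 -> b = single_zero l (zero_pos b).
Proof.
rewrite inE => /eqP b1; apply: val_inj.
apply: (@eq_from_nth _ true); rewrite ?size_mkseq size_tuple // => i ltil.
by rewrite nth_mkseq // nth_one_zero.
Qed.

Lemma zero_pos_arrivals1 l (b : l.-tuple bool) :
  b \in arrivals l 1 -> zero_pos b <= l.
Proof.
rewrite inE => /eqP b1; rewrite -[l in _ <= l](size_tuple b) index_mem.
by rewrite -has_pred1 has_count b1.
Qed.

Lemma single_zero_arrivals1 l p : 0 < p <= l -> single_zero l p \in arrivals l
  1.
Proof.
case: p => // p /= lt_pl; rewrite inE count_map.
rewrite (eq_count (a2 := pred1 p)) => [|i /=];
  last by rewrite eqSS eqbF_neg negbK.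
by rewrite count_uniq_mem ?iota_uniq // mem_iota /= add0n lt_pl.
Qed.

Lemma zero_pos_single_zero l p : 0 < p <= l -> zero_pos (single_zero l p) = p.
Proof.
move=> p_bnd; have b_arr := single_zero_arrivals1 p_bnd.
have := zero_pos_arrivals1 b_arr; move: b_arr; rewrite inE => /eqP.
move/(@nth_one_zero _ p.-1); rewrite nth_mkseq; last by lia.
rewrite prednK; last by lia.
by rewrite eqxx => /esym/negbFE/eqP.
Qed.

Lemma mem_right_cars l (c p : 'I_l.+1) :
  ((c, p) \in right_cars l) = [&& 0 < c, 0 < p & in_right p c].
Proof.
rewrite inE /=; apply/existsP/and3P => [[b /and3P[b_arr /eqP zp]]|[c0 p0 cp]].
  rewrite {1}(arrivals1E b_arr) right_lane_single_zero // zp.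
  by rewrite mem_filter mem_iota -zp; case/and3P.
have p_bnd : 0 < p <= l by rewrite p0 -ltnS ltn_ord.
exists (single_zero l p); rewrite single_zero_arrivals1 //.
rewrite zero_pos_single_zero // eqxx right_lane_single_zero //.
by rewrite mem_filter cp mem_iota c0 add1n ltn_ord.
Qed.

Lemma total_right1 l : total_right l 1 = l * uphalf l + (~~ odd l && (0 < l)).
Proof.
have arrE : arrivals l 1 = [set single_zero l p.+1 | p : 'I_l].
  apply/setP => b; apply/idP/imsetP => [b_arr|[p _ ->]].
    exists (Ordinal (zero_pos_arrivals1 b_arr)) => //=.
    exact: arrivals1E.
  by rewrite single_zero_arrivals1 //=.
rewrite /total_right arrE big_imset /=; last first.
  move=> p q _ _ /(congr1 (fun b : l.-tuple bool => zero_pos b)).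
  by rewrite !zero_pos_single_zero ?ltn_ord // => -[/ord_inj].
under eq_bigr => p _ do
  rewrite /final_right right_lane_single_zero // size_filter count_in_right //.
rewrite big_split sum_nat_const card_ord /=; congr (_ + _).
case: l {arrE} => [|l]; first by rewrite big_ord0.
rewrite big_ord_recr /= eqxx !andbT big1 // => i _.
by rewrite eqSS gtn_eqF ?andbF.
Qed.

(** The right lanes cover the set of pairs, so the union bound applies; equality falls out of the
    final comparison of cardinalities. *)
Lemma card_right_cars l : #|right_cars l| <= total_right l 1.
Proof.
pose cars (b : l.-tuple bool) : seq ('I_l.+1 * 'I_l.+1) :=
  [seq (inord c, inord (zero_pos b)) | c <- right_lane b].
have sub : right_cars l \subset \bigcup_(b in arrivals l 1) [set cp in cars b].
  apply/subsetP => -[c p]; rewrite inE => /existsP[b /and3P[b_arr /eqP zp cb]].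
  apply/bigcupP; exists b => //; rewrite inE; apply/mapP;
    exists (c : nat) => //.
  by rewrite zp !inord_val.
apply: leq_trans (subset_leq_card sub) _.
apply: (@leq_trans (\sum_(b in arrivals l 1) #|[set cp in cars b]|)).
  elim/big_rec2: _ => [|b n A _ le_An]; first by rewrite cards0.
  by rewrite (leq_trans (leq_card_setU _ _)) ?leq_add2l.
apply: leq_sum => b _; rewrite cardsE.
by rewrite (leq_trans (card_size _)) // size_map.
Qed.

(** * An explicit covering walk *)

(** Read as a walk, [t] traverses the edge {x, y} in one of the two directions. *)
Definition joins (T : eqType) (t : seq T) (x y : T) : bool :=
  infix [:: x; y] t || infix [:: y; x] t.

Lemma joinsC (T : eqType) (t : seq T) x y : joins t x y = joins t y x.
Proof. exact: orbC. Qed.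

Lemma joins_catl (T : eqType) (t1 t2 : seq T) x y :
  joins t2 x y -> joins (t1 ++ t2) x y.
Proof. by rewrite /joins => /orP[] /(infix_catl t1)->; rewrite ?orbT. Qed.

Lemma joins_catr (T : eqType) (t1 t2 : seq T) x y :
  joins t1 x y -> joins (t1 ++ t2) x y.
Proof. by rewrite /joins => /orP[] /(infix_catr t2)->; rewrite ?orbT. Qed.

Lemma joins_cons (T : eqType) (t : seq T) x y z :
  joins t x y -> joins (z :: t) x y.
Proof. exact: (@joins_catl _ [:: z]). Qed.

Lemma joins_head (T : eqType) (t : seq T) x y : joins [:: x, y & t] x y.
Proof. by rewrite /joins (prefix_infix [:: x; y] t). Qed.

Lemma joins_last (T : eqType) (t1 t2 : seq T) x y :
  joins (x :: t1 ++ y :: t2) (last x t1) y.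
Proof. by rewrite -cat_cons lastI cat_rcons joins_catl ?joins_head. Qed.

(** Prefixed by [a], the list reads a, m, b, m+1, a, m+2, ...: a walk through all edges between {a,
    b} and {m, ..., m+k-1}. *)
Fixpoint zigzag (a b m k : nat) : seq nat :=
  if k is k'.+1 then [:: m, b & zigzag b a m.+1 k'] else [::].

Lemma size_zigzag a b m k : size (zigzag a b m k) = k.*2.
Proof. by elim: k a b m => //= k IHk a b m; rewrite IHk. Qed.

Lemma last_zigzag a b m k : last a (zigzag a b m k) = if odd k then b else a.
Proof. by elim: k a b m => //= k IHk a b m; rewrite IHk; case: odd. Qed.

Lemma mem_zigzag a b m k v :
  v \in zigzag a b m k -> [|| v == a, v == b | m <= v < m + k].
Proof.
elim: k a b m => //= k IHk a b m; rewrite !inE.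
by case/or3P => [/eqP->|/eqP->|/IHk]; lia.
Qed.

Lemma joins_zigzag a b m k v : m <= v < m + k ->
  joins (a :: zigzag a b m k) v a /\ joins (a :: zigzag a b m k) v b.
Proof.
elim: k a b m => [|k IHk] a b m v_bnd; first by lia.
have [->|v_ne] := eqVneq v m => /=.
  split; first by rewrite joinsC joins_head.
  exact/joins_cons/joins_head.
have [|va vb] := IHk b a m.+1; first by lia.
by split; apply/joins_cons/joins_cons.
Qed.

(* The circuit from 1, deprived of its initial vertex, through the non-loop
   edges of the complete graph on 1, ..., 2k+1+e; when e holds, the edges of the
   perfect matching {1,2}, {3,4}, ... are avoided. *)
Fixpoint circuit (e : bool) (k : nat) : seq nat :=
  if k is k'.+1 then
    let n := k'.*2.+1 + e in
    n.+1 :: zigzag n.+1 n.+2 2 n.-1 ++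
      (if e then [::] else [:: n.+2]) ++ 1 :: circuit e k'
  else [::].

Lemma mem_circuit e k (v : nat) : v \in 1 :: circuit e k -> 0 < v <= k.*2.+1 +
  e.
Proof.
elim: k => [|k IHk]; first by rewrite inE => /eqP->; lia.
rewrite /= !(inE, mem_cat) => /or4P[/eqP->|/eqP->|/mem_zigzag|]; try by lia.
case/orP=> [|/IHk]; last by lia.
by case: e {IHk}; rewrite ?inE //= => /eqP->; lia.
Qed.

Lemma size_circuit e k : size (circuit e k) = k * (k.*2.+1 + e).
Proof.
elim: k => [//|k IHk]; rewrite /= !size_cat /= IHk size_zigzag.
by case: e {IHk} => /=; nia.
Qed.

Lemma last_circuit e k : last 1 (circuit e k) = 1.
Proof. by elim: k => //= k IHk; rewrite !last_cat /= IHk. Qed.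

Definition matched (i j : nat) : bool := odd i && (j == i.+1).

(** Induction adding two vertices n+1 and n+2: the outer round leaves 1 for n+1, zigzags over 2,
    ..., n and returns from n+2 to 1; edges within 1, ..., n are left to the inner circuit. *)
Lemma joins_circuit (e : bool) k i j : 0 < i < j -> j <= k.*2.+1 + e ->
  ~~ (e && matched i j) -> joins (1 :: circuit e k) i j.
Proof.
elim: k => [|k IHk] ij j_le ij_ok; first by move: ij_ok; rewrite /matched;
  case: e j_le; lia.
rewrite /=; move nE: (k.*2.+1 + e) => n.
rewrite (_ : k.*2 + e = n.-1); last by rewrite -nE.
set X := if e then _ else _.
have [j_le_n|j_gt_n] := leqP j n.
  do 2!apply: joins_cons; do 2!apply: joins_catl.
  by apply: IHk; rewrite ?nE.
(* The zigzag visits n-1 vertices: under [e] this is odd and it stops at n+2; otherwise it stops at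
   n+1 and [X] appends n+2. *)
have last_b : last n.+1 (zigzag n.+1 n.+2 2 n.-1 ++ X) = n.+2.
  by rewrite last_cat last_zigzag /X;
    case: e nE {j_le ij_ok IHk X} => /= nE //; case: ifP => //; lia.
have [i_gt1|i_le1] := ltnP 1 i; last first.
  have -> : i = 1 by lia.
  have [->|j_neq] := eqVneq j n.+1; first exact: joins_head.
  have -> : j = n.+2 by lia.
  have := joins_last (zigzag n.+1 n.+2 2 n.-1 ++ X) (circuit e k) n.+1 1.
  by rewrite last_b -catA joinsC => joins_b; apply: joins_cons.
apply: joins_cons; have [i_le_n|i_gt_n] := leqP i n.
  have [|ia ib] := @joins_zigzag n.+1 n.+2 2 n.-1 i; first by lia.
  rewrite -cat_cons; apply: joins_catr.
  by have [->|->] : j = n.+1 \/ j = n.+2 by lia.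
have -> : i = n.+1 by lia.
have -> : j = n.+2 by lia.
have e_false : e = false.
  by move: ij_ok; rewrite /matched; case: e nE j_le {X last_b IHk}; lia.
have := joins_last (zigzag n.+1 n.+2 2 n.-1) (1 :: circuit e k) n.+1 n.+2.
by rewrite last_zigzag /X e_false ifN //; lia.
Qed.

(** * Inserting loops into a walk *)

Lemma joins1 (T : eqType) (z x y : T) : joins [:: z] x y = false.
Proof. by rewrite /joins /= !andbF. Qed.

Lemma joinsE (T : eqType) (t : seq T) x y i j : joins [:: x, y & t] i j =
  [|| (x == i) && (y == j), (x == j) && (y == i) | joins (y :: t) i j].
Proof.
rewrite /joins /= !prefix0s !andbT (eq_sym i x) (eq_sym j y) (eq_sym j x).
by rewrite (eq_sym i y); do !case: (_ == _) => //=; rewrite ?orbT.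
Qed.

(** Doubling the last occurrence of each vertex inserts its loop exactly once and keeps all other
    steps. *)
Fixpoint add_loops (T : eqType) (t : seq T) : seq T :=
  if t is x :: t' then
    if x \in t' then x :: add_loops t' else [:: x, x & add_loops t']
  else [::].

Lemma size_add_loops (T : eqType) (t : seq T) :
  size (add_loops t) = size t + size (undup t).
Proof. by elim: t => //= x t IHt; case: ifP => _ /=; rewrite IHt ?addnS. Qed.

Lemma mem_add_loops (T : eqType) (t : seq T) : add_loops t =i t.
Proof.
elim: t => //= x t IHt y.
by case: ifP => _; rewrite !inE IHt // orbA orbb.
Qed.

Lemma add_loops_cons (T : eqType) x (t : seq T) :
  add_loops (x :: t) = x :: behead (add_loops (x :: t)).
Proof. by rewrite /=; case: ifP. Qed.

Lemma joins_add_loops (T : eqType) (t : seq T) x y :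
  joins t x y -> joins (add_loops t) x y.
Proof.
elim: t => [//|z [|w t] IHt]; first by rewrite joins1.
rewrite joinsE orbA => /orP[zw_xy|/IHt]; last first.
  by rewrite [add_loops (z :: _)]/=; case: ifP => _ ?; do ?apply: joins_cons.
have : joins (z :: add_loops (w :: t)) x y.
  by rewrite add_loops_cons joinsE orbA zw_xy.
by rewrite [add_loops (z :: _)]/=; case: ifP => _ // ?; apply: joins_cons.
Qed.

Lemma joins_loop (T : eqType) (t : seq T) x :
  x \in t -> joins (add_loops t) x x.
Proof.
elim: t => //= y t IHt; rewrite inE; case: eqVneq => [<-|_] /=.
  by case: ifP => [/IHt|_ _]; [move=> ? _;
    apply: joins_cons | exact: joins_head].
by move/IHt => ?; case: ifP => _; do ?apply: joins_cons.
Qed.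

(** For even [l] this is a perfect matching of 1, ..., l-2; the bound [j < l] spares {l-1, l}. *)
Definition skipped (l i j : nat) : bool := [&& ~~ odd l, matched i j & j < l].

(* When l is even, l - 1 and l are the only vertices of odd degree once the
   skipped edges are removed, so they are the endpoints. *)
Definition tour (l : nat) : seq nat :=
  if odd l then 1 :: circuit false l./2
  else if l <= 2 then [:: 1; 2]
  else l.-1 :: zigzag l.-1 l 2 (l - 3) ++
         1 :: circuit true (l./2 - 2) ++ [:: l.-1; l].

Lemma tour_range l v : 0 < l -> v \in tour l -> 0 < v <= l.
Proof.
rewrite /tour => l_gt0; case: ifP => l_odd.
  by move/mem_circuit; lia.
case: ifP => l_le2; first by rewrite !inE; lia.
rewrite in_cons mem_cat -cat_cons mem_cat !in_cons in_nil =>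
  /or4P[/eqP->|/mem_zigzag|/mem_circuit|]; lia.
Qed.

Lemma size_tour l : 0 < l ->
  (size (tour l)).-1 + (if odd l then 0 else l./2.-1) = 'C(l, 2).
Proof.
(* Clearing the division in the binomial, and writing l as 2k+1 or 2k+4 below, leaves polynomial
   identities for [nia]. *)
move=> l_gt0; have binE : 'C(l, 2) * 2 = l * l.-1.
  by rewrite -[in LHS]/(2`!) bin_ffact ffactnS ffactn1.
rewrite /tour; case: ifP => l_odd.
  have lE : l = l./2.*2.+1 by lia.
  rewrite /= size_circuit; move: (l./2) lE binE => k ->; nia.
case: ifP => l_le2; first by have lE : l = 2 by [lia]; rewrite lE.
have lE : l = (l./2 - 2).+2.*2 by lia.
rewrite /= size_cat size_zigzag /= size_cat size_circuit /=.
by move: (l./2 - 2) lE binE => k ->; nia.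
Qed.

Lemma joins_tour l i j : 0 < i < j -> j <= l -> ~~ skipped l i j ->
  joins (tour l) i j.
Proof.
rewrite /tour => ij j_le_l ij_ok; case: ifP => l_odd.
  by apply: joins_circuit; lia.
case: ifP => l_le2.
  have -> : i = 1 by lia.
  by have -> : j = 2 by lia.
have l_gt3 : 3 < l by lia.
(* Edges within 1, ..., l-2 belong to the inner circuit; the zigzag joins l-1 and l to 2, ..., l-2,
   and the remaining steps give {l, 1}, {1, l-1} and {l-1, l}. *)
have [j_small|j_big] := leqP j l.-2.
  rewrite -cat_cons -cat_cons; apply/joins_catl/joins_catr.
  by apply: joins_circuit; move: ij_ok; rewrite /skipped; lia.
have [i_eq|i_neq] := eqVneq i l.-1.
  have -> : j = l by lia.
  rewrite i_eq -cat_cons; apply: joins_catl; rewrite -cat_cons.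
  exact/joins_catl/joins_head.
have [i_gt1|i_le1] := ltnP 1 i.
  have [|ia ib] := @joins_zigzag l.-1 l 2 (l - 3) i; first by lia.
  rewrite -cat_cons; apply: joins_catr.
  by have [->|->] : j = l.-1 \/ j = l by lia.
have -> : i = 1 by lia.
have [->|j_neq] := eqVneq j l.-1.
  rewrite -cat_cons; apply: joins_catl.
  have := joins_last (circuit true (l./2 - 2)) [:: l] 1 l.-1.
  by rewrite last_circuit.
have -> : j = l by lia.
set c := circuit _ _ ++ _.
have := joins_last (zigzag l.-1 l 2 (l - 3)) c l.-1 1.
by rewrite last_zigzag ifT 1?joinsC //; lia.
Qed.

Lemma joins_mem (T : eqType) (t : seq T) x y : joins t x y -> x \in t.
Proof. by case/orP => /mem_infix; apply; rewrite !inE eqxx ?orbT. Qed.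

(** No edge at [l] is skipped, so the step between [i] and [l] places every other vertex on the
    tour. *)
Lemma vertex_in_tour l i : 0 < i <= l -> i \in tour l.
Proof.
move=> i_bnd; have [l1|l_neq1] := eqVneq l 1.
  have -> : i = 1 by lia.
  by rewrite l1.
have [il|i_neq] := eqVneq i l.
  by apply: (@joins_mem _ _ _ 1); rewrite joinsC; apply: joins_tour;
    rewrite /skipped; lia.
by apply: (@joins_mem _ _ _ l); apply: joins_tour; rewrite /skipped; lia.
Qed.

(** * Trails in the complete graph with loops *)

Lemma walk_edges_joins (T : eqType) (U : finType) (f : T -> U) x s i j :
  joins (x :: s) i j -> [set f i; f j] \in walk_edges (f x) (map f s).
Proof.
elim: s x => [|y s IHs] x; first by rewrite joins1.
rewrite joinsE inE => /or3P[/andP[/eqP-> /eqP->]|/andP[/eqP-> /eqP->]|/IHs->].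
- by rewrite eqxx.
- by rewrite setUC eqxx.
- by rewrite orbT.
Qed.

Section LoopedCompleteGraph.

Variables (T : finType) (V : {set T}).

Implicit Types (v x : T) (s : seq T) (e : {set T}).

Let E : {set {set T}} := [set [set i; j] | i in V, j in V].

(** Edges are the subsets of [V] with one or two elements; Pascal's rule adds up the two counts. *)
Lemma card_looped_complete : #|E| = 'C(#|V|.+1, 2).
Proof.
have -> : E = [set A : {set T} | A \subset V & #|A| == 2] :|:
              [set A : {set T} | A \subset V & #|A| == 1].
  apply/setP => A; rewrite !inE -andb_orr.
  apply/idP/idP => [/imset2P[i j iV jV ->]|/andP[AV]].
    by rewrite subUset !sub1set iV jV cards2; case: (i != j).
  case/orP => [/cards2P[i [j [_ AE]]]|/cards1P[i AE]]; move: AV; rewrite AE.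
    by rewrite subUset !sub1set => /andP[iV jV]; apply: imset2_f.
  by rewrite sub1set -(setUid [set i]) => iV; apply: imset2_f.
rewrite cardsU !cards_draws binS bin1 disjoint_setI0 ?cards0 ?subn0 ?bin1 //.
by rewrite disjoints_subset; apply/subsetP => A;
  rewrite !inE => /andP[_ /eqP->]; rewrite andbF.
Qed.

Lemma mem_walk_edges x s : walk V E x s -> {subset walk_edges x s <= E}.
Proof.
case/andP=> _; elim: s x => //= y s IHs x /andP[xy /IHs ys] e.
by rewrite inE => /predU1P[->|/ys].
Qed.

Lemma walk_in_vertices x s : all [in V] (x :: s) -> walk V E x s.
Proof.
rewrite /walk => /= /andP[xV sV]; rewrite xV /=.
elim: s x xV sV => //= y s IHs x xV /andP[yV sV].
by rewrite IHs // andbT; apply: imset2_f.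
Qed.

(** A step between distinct vertices flips the parity at both of its ends, and telescoping leaves
    only the endpoints of the walk; loops have cardinality 1 and are not counted. *)
Lemma odd_degree_walk v x s :
  odd (count (fun e => (v \in e) && (#|e| == 2)) (walk_edges x s)) =
  (v == x) (+) (v == last x s).
Proof.
elim: s x => [|y s IHs] x /=; first by rewrite addbb.
rewrite oddD IHs !inE cards2 eqSS eqb1.
case: (eqVneq x y) => [->|xy]; first by rewrite andbF.
rewrite andbT; case: (eqVneq v x) => [->|_] /=; rewrite ?(negPf xy) //.
by case: (v == y) => //=; case: (_ == _).
Qed.

Lemma card_star v : v \in V ->
  #|[set e in E | (v \in e) && (#|e| == 2)]| = #|V|.-1.
Proof.
move=> vV; have -> : [set e in E | (v \in e) && (#|e| == 2)] =
                     [set [set v; w] | w in V :\ v].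
  apply/setP => e; rewrite inE; apply/andP/imsetP.
    move=> [/imset2P[i j iV jV ->]]; rewrite !inE cards2 eqSS eqb1.
    case/andP=> /orP[/eqP->|/eqP->] ij.
      by exists j; rewrite // !inE eq_sym ij.
    by exists i; [rewrite !inE ij | apply: setUC].
  move=> [w]; rewrite !inE => /andP[wv wV] ->.
  by rewrite cards2 set21 (eq_sym v) wv; split=> //; apply: imset2_f.
rewrite card_in_imset ?(cardsD1 v V) ?vV // => w w';
  rewrite !inE => /andP[wv _] _.
by move/setP/(_ w); rewrite !inE eqxx orbT (negPf wv) /= => /esym/eqP.
Qed.

(* Every vertex other than the endpoints has an even degree along the trail but
   an odd degree in the complete graph, so that some non-loop edge at it is
   unused; each unused edge serves two vertices. *)
Lemma size_trail_even x s : ~~ odd #|V| -> trail V E x s ->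
  size s + #|V|./2.-1 <= #|E|.
Proof.
move=> V_even /andP[/mem_walk_edges sE s_uniq].
pose W := [set e in walk_edges x s].
have sub_WE : W \subset E by apply/subsetP => e; rewrite inE; apply: sE.
have card_W : #|W| = size s.
  by rewrite cardsE (card_uniqP s_uniq) size_pairmap.
pose D := [set e in E :\: W | #|e| == 2].
have cover_D : V :\: [set x; last x s] \subset cover D.
  apply/subsetP => v; rewrite !inE negb_or => /andP[/andP[vx vl] vV].
  apply: contraT => v_notin.
  have := odd_degree_walk v x s; rewrite (negPf vx) (negPf vl) /=.
  rewrite -size_filter -(card_uniqP (filter_uniq _ s_uniq)).
  rewrite (eq_card (B := [set e in E | (v \in e) && (#|e| == 2)])) => [|e].
    have := cardsD1 v V; rewrite card_star // vV; move: V_even; lia.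
  rewrite mem_filter [RHS]inE [RHS]andbC.
  case: (boolP ((v \in e) && _)) => //= /andP[ve e2];
    apply/idP/idP => [/sE //|eE].
  apply: contraR v_notin => e_notin; apply/bigcupP; exists e => //.
  by rewrite !inE e_notin eE.
have card_D : #|D| + size s <= #|E|.
  rewrite -card_W addnC -(cardsID W E) (setIidPr sub_WE) leq_add2l.
  by apply/subset_leq_card/subsetP => e; rewrite inE => /andP[].
(* This gives #|V| - 2 <= #|cover D| <= 2 #|D|. *)
have := leq_trans (subset_leq_card cover_D) (leq_card_cover D).
rewrite (eq_bigr (fun=> 2)) => [|e]; last by rewrite inE => /andP[_ /eqP].
have := cardsID [set x; last x s] V.
have := subset_leq_card (subsetIr V [set x; last x s]); rewrite cards2.
by rewrite sum_nat_const; lia.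
Qed.

End LoopedCompleteGraph.

(** * The image of rho *)

Lemma card_vertices l : #|vertices l| = l.
Proof.
have -> : vertices l = ~: [set ord0].
  by apply/setP => v; rewrite !inE -val_eqE /= lt0n.
by rewrite cardsC1 card_ord.
Qed.

Lemma inord_vertices l i : 0 < i <= l -> inord i \in vertices l.
Proof. by case/andP=> i_gt0 i_le; rewrite inE inordK. Qed.

Definition skipped_edges (l : nat) : {set {set 'I_l.+1}} :=
  if odd l then set0
  else [set edge l (k : nat).*2.+1 k.*2.+2 | k : 'I_(l./2.-1)].

Definition trail_edges (l : nat) : {set {set 'I_l.+1}} :=
  looped_complete l :\: skipped_edges l.

Definition trail_length (l : nat) : nat :=
  'C(l.+1, 2) - (if odd l then 0 else l./2.-1).

Lemma leq_card_trail_edges l : trail_length l <= #|trail_edges l|.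
Proof.
rewrite /trail_edges cardsD card_looped_complete card_vertices leq_sub2l //.
apply: leq_trans (subset_leq_card (subsetIr _ _)) _.
rewrite /skipped_edges; case: ifP => _; first by rewrite cards0.
by rewrite (leq_trans (leq_imset_card _ _)) // card_ord.
Qed.

Lemma trail_edgesP l e : e \in trail_edges l ->
  exists i j, [/\ 0 < i <= j, j <= l, ~~ skipped l i j & e = edge l i j].
Proof.
have ordered (i j : 'I_l.+1) : i <= j -> 0 < i ->
    [set i; j] \notin skipped_edges l ->
    exists i' j', [/\ 0 < i' <= j', j' <= l, ~~ skipped l i' j'
                    & [set i; j] = edge l i' j'].
  move=> le_ij i_gt0 ij_kept; exists i, j; rewrite i_gt0 le_ij -ltnS ltn_ord.
  rewrite /edge !inord_val; split=> //; apply: contra ij_kept.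
  case/and3P=> l_even /andP[i_odd /eqP j_eq] j_lt.
  rewrite /skipped_edges (negPf l_even).
  have k_lt : i./2 < l./2.-1 by lia.
  apply/imsetP; exists (Ordinal k_lt) => //=.
  have iE : i./2.*2.+1 = i by lia.
  by rewrite iE -j_eq /edge !inord_val.
case/setDP=> /imset2P[i j]; rewrite !inE => i_gt0 j_gt0 ->.
have [le_ij|/ltnW le_ji] := leqP i j; first exact: ordered.
by rewrite setUC; apply: ordered.
Qed.

Lemma leq_size_trail l x s : 0 < l ->
  trail (vertices l) (looped_complete l) x s -> size s <= trail_length l.
Proof.
move=> l_gt0 s_trail; have := size_trail s_trail.
rewrite /trail_length card_looped_complete card_vertices.
case: ifP => [_|l_even _]; first by rewrite subn0.
have := size_trail_even _ s_trail.
by rewrite card_looped_complete card_vertices l_even => /(_ isT); lia.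
Qed.

Lemma trail_edges_traversed l : 0 < l -> exists x s,
  [/\ walk (vertices l) (looped_complete l) x s, size s <= trail_length l
    & {subset trail_edges l <= walk_edges x s}].
Proof.
move=> l_gt0; case tourE: (add_loops (tour l)) => [|x s].
  have := size_tour l_gt0; move/(congr1 size): tourE;
    rewrite size_add_loops /tour.
  by case: ifP => //; case: ifP.
have tour_bnd v : v \in x :: s -> 0 < v <= l.
  by rewrite -tourE mem_add_loops; apply: tour_range.
exists (inord x), (map inord s); split.
- apply: walk_in_vertices; rewrite -map_cons;
  apply/allP => v /mapP[i /tour_bnd].
  by move=> i_bnd ->; apply: inord_vertices.
(* One loop is added per distinct vertex, hence at most [l] in all, on top of the steps counted by
   [size_tour]. *)
- have : size (undup (tour l)) <= size (iota 1 l).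
    apply: uniq_leq_size; rewrite ?undup_uniq // => v; rewrite mem_undup.
    by move/(tour_range l_gt0); rewrite mem_iota add1n ltnS.
  have := size_tour l_gt0; have := congr1 size tourE.
  rewrite size_add_loops size_iota size_map /trail_length binS bin1 /=.
  have : 0 < size (tour l) by rewrite /tour; do 2?[case: ifP => //].
  by case: ifP => _; lia.
move=> e /trail_edgesP[i [j [/andP[i_gt0 le_ij] j_le ij_ok ->]]].
apply: walk_edges_joins; rewrite -tourE.
have joins_lt i' j' : 0 < i' < j' -> j' <= l -> ~~ skipped l i' j' ->
  joins (add_loops (tour l)) i' j' by move=> *;
    apply/joins_add_loops/joins_tour.
move: le_ij; rewrite leq_eqVlt => /predU1P[ij|lt_ij];
  last by rewrite joins_lt ?i_gt0.
by rewrite -ij; apply: joins_loop; rewrite vertex_in_tour // i_gt0 ij.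
Qed.

(** Preimages by parity of i < j: (j, i) for odd-odd, (i, j) for odd-even, (i-1, j) for even-odd,
    (j+1, i) for even-even; a loop comes from (i, i). *)
Lemma rho_surjective l e : e \in trail_edges l ->
  e \in [set rho l cp.1 cp.2 | cp : 'I_l.+1 * 'I_l.+1 in right_cars l].
Proof.
case/trail_edgesP=> i [j [/andP[i_gt0 le_ij] j_le ij_ok ->]].
have l_gt0 : 0 < l by lia.
have car c p : 0 < c <= l -> 0 < p <= l -> in_right p c ->
    rho l c p = edge l i j ->
    edge l i j \in [set rho l cp.1 cp.2 | cp : 'I_l.+1 * 'I_l.+1 in right_cars
      l].
  move=> /andP[c_gt0 c_le] /andP[p_gt0 p_le] cp <-.
  apply/imsetP; exists (inord c, inord p); last by rewrite /= !inordK.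
  by rewrite mem_right_cars !inordK ?c_gt0 ?p_gt0.
have [ij|ij] := eqVneq i j.
  apply: (car i i); rewrite /in_right ?eqxx ?orbT; try lia.
  by rewrite -ij /rho ltnn eqxx leqnn; do ?[case: ifP => ? //]; lia.
move: ij_ok; rewrite /skipped /matched => ij_ok.
have [i_odd|i_even] := boolP (odd i); have [j_odd|j_even] := boolP (odd j).
- apply: (car j i); rewrite /in_right; try lia.
  by rewrite /rho i_odd; do ?[case: ifP => ? //]; lia.
- apply: (car i j); rewrite /in_right; try lia.
  by rewrite /rho (negPf j_even); do ?[case: ifP => ? //]; lia.
- apply: (car i.-1 j); rewrite /in_right; try lia.
  by rewrite /rho j_odd prednK; do ?[case: ifP => ? //]; lia.
(* Car j+1 is missing when j = l. The pair (i-1, i) is then free, since {i-1, i} is skipped, and the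
   exceptional clause of [rho] sends it to {i, l}. *)
have [l_case|l_case] := boolP (~~ odd l && (j == l)).
  case/andP: l_case => l_even /eqP jl.
  apply: (car i.-1 i); rewrite /in_right; try lia.
  by rewrite /rho jl (negPf i_even); do ?[case: ifP => ? //]; lia.
apply: (car j.+1 i); rewrite /in_right; try lia.
by rewrite /rho (negPf i_even); do ?[case: ifP => ? //]; lia.
Qed.

(** * Comparison of cardinalities *)

Lemma total_right1_trail_length l : 0 < l -> total_right l 1 = trail_length l.
Proof.
move=> l_gt0; rewrite total_right1 l_gt0 andbT /trail_length.
have binE : 'C(l.+1, 2) * 2 = l.+1 * l.
  by rewrite -[in LHS]/(2`!) bin_ffact ffactnS ffactn1.
(* Both sides equal (2k+1)(k+1) for l = 2k+1, and 2k^2+1 for l = 2k. *)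
case: ifP => l_odd.
  have [lE uE] : l = l./2.*2.+1 /\ uphalf l = l./2.+1 by lia.
  by rewrite uE; move: (l./2) lE binE => k ->; nia.
have [lE uE] : l = l./2.*2 /\ uphalf l = l./2 by lia.
have : 0 < l./2 by lia.
by rewrite uE; move: (l./2) lE binE => k ->; nia.
Qed.

Theorem proposition5p3 (l : nat) (hl : 1 <= l) :
  {in right_cars l &,
     injective (fun cp : 'I_l.+1 * 'I_l.+1 => rho l cp.1 cp.2)}
  /\ (exists (x : 'I_l.+1) (s : seq 'I_l.+1),
        longest_trail (vertices l) (looped_complete l) x s
        /\ [set rho l cp.1 cp.2 | cp : 'I_l.+1 * 'I_l.+1 in right_cars l]
           = [set e in walk_edges x s])
  /\ total_right l 1 = longest_trail_length l.
Proof.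
set image := [set rho l cp.1 cp.2 | cp : 'I_l.+1 * 'I_l.+1 in right_cars l].
have sub_image : trail_edges l \subset image.
  by apply/subsetP => e; apply: rho_surjective.
have le_image : #|image| <= #|right_cars l| := leq_imset_card _ _.
have le_cars := card_right_cars l;
  rewrite total_right1_trail_length // in le_cars *.
have le_edges := leq_card_trail_edges l.
(* The chain #|trail_edges l| <= #|image| <= #|right_cars l| <= [trail_length l] <= #|trail_edges l|
   forces equalities throughout. *)
have imageE : image = trail_edges l.
  apply/esym/eqP; rewrite eqEcard sub_image.
  exact: leq_trans le_image (leq_trans le_cars le_edges).
rewrite imageE in le_image.
have card_edges : #|trail_edges l| = trail_length l.
  by apply/eqP; rewrite eqn_leq le_edges (leq_trans le_image).
have [x [s [s_walk s_size sub_s]]] := trail_edges_traversed hl.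
(* A list of at most [trail_length l] entries containing that many distinct edges has no repetition
   and no further entry; so the walk is a trail. *)
have [sz_s s_edges] :
    (size (enum (trail_edges l)) = size (walk_edges x s)) *
    (enum (trail_edges l) =i walk_edges x s).
  apply: uniq_min_size; first exact: enum_uniq.
    by move=> e; rewrite mem_enum; apply: sub_s.
  by rewrite size_pairmap -cardE card_edges.
have size_s : size s = trail_length l.
  by rewrite -card_edges cardE sz_s size_pairmap.
have s_trail : trail (vertices l) (looped_complete l) x s.
  rewrite /trail s_walk /= -(eq_uniq sz_s s_edges) enum_uniq //.
have max_s : max_trail (vertices l) (looped_complete l) = trail_length l.
  apply/eqP; rewrite eqn_leq -{2}size_s (leq_max_trail s_trail) andbT.
  apply/bigmax_leqP => m /existsP[y /existsP[t /(leq_size_trail hl)]].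
  by rewrite size_tuple.
split.
  (* Image and domain have the same finite size, which gives injectivity. *)
  by apply/imset_injP; rewrite -/image imageE eqn_leq le_image card_edges.
split; last by rewrite /longest_trail_length max_s.
exists x, s; split; first by rewrite /longest_trail s_trail max_s size_s eqxx.
by rewrite imageE; apply/setP => e; rewrite [RHS]inE -s_edges mem_enum.
Qed.
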